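(* Let $d,m\in\mathbb{N}$, $n=2m-2$, and let $J_n$ be the Jackson kernel of degree $n$ on $\mathbb{T}^d$. Then for every $\mu\in\mathcal{M}$ $$W_1(J_n*\mu,\mu)\le\frac{3}{2}\cdot\frac{d\cdot\|\mu\|_{\mathrm{TV}}}{n+2}.$$
   Context: $\mathbb{N}=\{1,2,\dots\}$, $\mathbb{T}^d=[0,1)^d$ is the torus with wrap-around distance $|x-y|_1=\min_{k\in\mathbb{Z}^d}\|x-y+k\|_1$. $\mathcal{M}$ is the set of complex Borel measures $\mu$ on $\mathbb{T}^d$ of finite total variation $\|\mu\|_{\mathrm{TV}}$ with $\mu(\mathbb{T}^d)=1$. The Jackson kernel is $J_{2m-2}(x)=\frac{3}{m(2m^2+1)}\frac{\sin^4(m\pi x)}{\sin^4(\pi x)}$ for $x\in\mathbb{T}$ (extended continuously at $x=0$), and $J_n(x_1,\dots,x_d)=J_n(x_1)\cdots J_n(x_d)$ on $\mathbb{T}^d$; $(J_n*\mu)(x)=\int_{\mathbb{T}^d}J_n(x-y)\,\mathrm{d}\mu(y)$. For $f:\mathbb{T}^d\to\mathbb{R}$, $\operatorname{Lip}(f)\le1$ means $|f(x)-f(y)|\le|x-y|_1$ for all $x,y$. $W_1(\nu,\mu)=\sup_{\operatorname{Lip}(f)\le1}\left|\int_{\mathbb{T}^d}f\,\mathrm{d}(\nu-\mu)\right|$, and $W_1(p,\mu)$ means $W_1(\nu,\mu)$ with $\mathrm{d}\nu(x)=p(x)\,\mathrm{d}x$. *)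

(* Defs.v *)
From HB Require Import structures.
From mathcomp Require Import all_boot all_order all_algebra.
From mathcomp Require Import all_classical all_reals all_analysis.
From mathcomp Require Import complex.

Set Implicit Arguments.
Unset Strict Implicit.
Unset Printing Implicit Defensive.

Import Order.TTheory GRing.Theory Num.Theory.
Import numFieldNormedType.Exports.

Local Open Scope classical_set_scope.
Local Open Scope ring_scope.
Local Open Scope complex_scope.

Definition circle (R : realType) : Type := {x : R | (0 <= x) && (x < 1)}.

Section circle_measurable.
Variable R : realType.

Lemma circle0_subproof : (0 <= (0 : R)) && ((0 : R) < 1).
Proof. by rewrite lexx ltr01. Qed.

HB.instance Definition _ := Choice.on (circle R).
HB.instance Definition _ :=
  isPointed.Build (circle R) (exist _ 0 circle0_subproof).

(* The Borel sets of [0, 1); they are also the Borel sets of the quotient R/Z. *)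
Definition circle_measurable : set (set (circle R)) :=
  preimage_set_system setT (val : circle R -> R) measurable.

Let sigma_algebra_circle : sigma_algebra setT circle_measurable.
Proof. exact/sigma_algebra_preimage/sigma_algebra_measurable. Qed.

Lemma circle_measurable0 : circle_measurable set0.
Proof. by case: sigma_algebra_circle. Qed.

Lemma circle_measurableC A : circle_measurable A -> circle_measurable (~` A).
Proof. by case: sigma_algebra_circle => _ + _ => /[apply]; rewrite setTD. Qed.

Lemma circle_bigcup (F : (set (circle R))^nat) :
  (forall i, circle_measurable (F i)) -> circle_measurable (\bigcup_i F i).
Proof. by case: sigma_algebra_circle => _ _; exact. Qed.

HB.instance Definition _ := @isMeasurable.Build default_measure_display
  (circle R) circle_measurable
  circle_measurable0 circle_measurableC circle_bigcup.

Lemma image_circle_setT : [set val x | x in [set: circle R]] = `[0, 1[%classic.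
Proof.
apply/seteqP; split => [_ [[x x01] _ <-]|x]; rewrite /= in_itv//=.
by move=> x01; exists (exist _ x x01).
Qed.

Lemma measurable_image_circle (A : set (circle R)) :
  measurable A -> measurable [set val x | x in A].
Proof.
move=> [B mB] <-; rewrite setTI.
suff -> : [set val x | x in (val : circle R -> R) @^-1` B] = B `&` `[0, 1[%classic.
  exact: measurableI.
rewrite -image_circle_setT; apply/seteqP; split.
  by move=> _ [x Bx] <-; split=> //; exists x.
by move=> t [Bt [x _ xE]]; exists x => //=; rewrite xE.
Qed.

End circle_measurable.

Section lebesgue_circle.
Variable R : realType.
Local Open Scope ereal_scope.

Definition lebesgue_circle (A : set (circle R)) : \bar R :=
  lebesgue_measure [set val x | x in A].

Let lebesgue_circle0 : lebesgue_circle set0 = 0.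
Proof. by rewrite /lebesgue_circle image_set0 measure0. Qed.

Let lebesgue_circle_ge0 A : 0 <= lebesgue_circle A.
Proof. exact: measure_ge0. Qed.

Let lebesgue_circle_sigma_additive : semi_sigma_additive lebesgue_circle.
Proof.
move=> F mF tF mUF; rewrite /lebesgue_circle image_bigcup.
apply: measure_semi_sigma_additive.
- by move=> n; exact: measurable_image_circle.
- move=> i j _ _ [_ [[x Fix <-] [y Fjy /val_inj yx]]].
  by apply: tF => //; exists x; split => //; rewrite -yx.
- by rewrite -image_bigcup; exact: measurable_image_circle.
Qed.

HB.instance Definition _ := isMeasure.Build _ _ _ lebesgue_circle
  lebesgue_circle0 lebesgue_circle_ge0 lebesgue_circle_sigma_additive.

Let lebesgue_circle_setT : lebesgue_circle setT = 1.
Proof.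
rewrite /lebesgue_circle image_circle_setT lebesgue_measure_itv/=.
by rewrite lte_fin ltr01 -EFinB subr0.
Qed.

HB.instance Definition _ := Measure_isProbability.Build _ _ _
  lebesgue_circle lebesgue_circle_setT.

End lebesgue_circle.

Section tuple_probability.
Context d (T : measurableType d) (R : realType) (P : probability T R).

Definition consT n (x : T * n.-tuple T) : n.+1.-tuple T := [tuple of x.1 :: x.2].

Lemma measurable_consT n : measurable_fun setT (@consT n).
Proof. exact: measurable_cons. Qed.

HB.instance Definition _ n :=
  isMeasurableFun.Build _ _ _ _ (@consT n) (@measurable_consT n).

Fixpoint tuple_probability n : probability (n.-tuple T) R :=
  if n is n'.+1 then distribution (P \x tuple_probability n')%E (@consT n')
  else \d_[tuple].

End tuple_probability.

(* The sigma-algebra on tuples is the product one, which here is the Borel one. *)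
Definition torus (d : nat) (R : realType) := d.-tuple (circle R).

Definition lebesgue_torus d (R : realType) : probability (torus d R) R :=
  tuple_probability (@lebesgue_circle R) d.

Definition torus_coord d (R : realType) (x : torus d R) (i : 'I_d) : R :=
  val (tnth x i).

(* The infimum over k is attained. *)
Definition torus_dist d (R : realType) (x y : torus d R) : R :=
  inf [set \sum_(i < d) `|torus_coord x i - torus_coord y i + (k i)%:~R|
      | k in [set: 'I_d -> int]].

Definition Lip1 d (R : realType) : set (torus d R -> R) :=
  [set f | forall x y, `|f x - f y| <= torus_dist x y].

(* Charges are countably additive and finite on measurable sets, so that a pair of
   them is the same thing as a countably additive function with values in R[i],
   given below by cmeasure. *)
Record complex_measure d (T : measurableType d) (R : realType) := ComplexMeasure {
  re_part : {charge set T -> \bar R} ;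
  im_part : {charge set T -> \bar R} }.

Section charge_integral.
Context d (T : measurableType d) (R : realType).
Variable nu : {charge set T -> \bar R}.

Let P_ex := cid (Hahn_decomposition nu).
Let N_ex := cid (svalP P_ex).

(* The value does not depend on the chosen Hahn decomposition. *)
Definition charge_integral (f : T -> R) : R :=
  \int[jordan_pos (svalP N_ex)]_x f x - \int[jordan_neg (svalP N_ex)]_x f x.

End charge_integral.

Section complex_measure.
Context d (T : measurableType d) (R : realType).
Implicit Types mu nu : complex_measure T R.

Definition cmeasure mu (A : set T) : R[i] :=
  fine (re_part mu A) +i* fine (im_part mu A).

Definition cintegral mu (f : T -> R) : R[i] :=
  charge_integral (re_part mu) f +i* charge_integral (im_part mu) f.

Definition cmeasure_sub mu nu : complex_measure T R :=
  ComplexMeasure (cadd (re_part mu) (copp (re_part nu)))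
                 (cadd (im_part mu) (copp (im_part nu))).

Definition tv_norm mu : \bar R :=
  ereal_sup [set (\sum_(0 <= k <oo) (Normc.normc (cmeasure mu (A k)))%:E)%E
            | A in [set A : (set T)^nat | [/\ forall k, measurable (A k),
                trivIset setT A & \bigcup_k A k = setT]]].

Section density.
Variable lambda : {measure set T -> \bar R}.

(* The charge f d(lambda); the default value czero is used only when f is not
   integrable. *)
Definition charge_density (f : T -> R) : {charge set T -> \bar R} :=
  match pselect (lambda.-integrable setT (EFin \o f)) with
  | left intf => induced_charge intf
  | right _ => czero
  end.

Definition cdensity (p : T -> R[i]) : complex_measure T R :=
  ComplexMeasure (charge_density (fun x => complex.Re (p x)))
                 (charge_density (fun x => complex.Im (p x))).

End density.

End complex_measure.

Definition calM d (R : realType) (mu : complex_measure (torus d R) R) : Prop :=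
  (tv_norm mu < +oo)%E /\ cmeasure mu setT = 1.

Section jackson.
Variable R : realType.

Definition jackson_quotient (m : nat) (x : R) : R :=
  3 / (m%:R * (2 * m%:R ^+ 2 + 1)) *
  (sin (m%:R * pi * x) ^+ 4 / sin (pi * x) ^+ 4).

(* The kernel of degree 2m - 2, as a 1-periodic function on the real line:
   the quotient extended continuously at the integers. *)
Definition jackson1 (m : nat) (x : R) : R :=
  if sin (pi * x) == 0 then lim (jackson_quotient m y @[y --> x^'])
  else jackson_quotient m x.

Definition jackson d (m : nat) (z : 'I_d -> R) : R :=
  \prod_(i < d) jackson1 m (z i).

(* By 1-periodicity of jackson1, x - y may be computed on the representatives
   in [0, 1)^d. *)
Definition jackson_conv d (m : nat) (mu : complex_measure (torus d R) R)
    (x : torus d R) : R[i] :=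
  cintegral mu (fun y => jackson m (fun i => torus_coord x i - torus_coord y i)).

End jackson.

Definition W1 d (R : realType) (nu mu : complex_measure (torus d R) R) : \bar R :=
  ereal_sup [set (Normc.normc (cintegral (cmeasure_sub nu mu) f))%:E
            | f in @Lip1 d R].

Definition W1_density d (R : realType) (p : torus d R -> R[i])
    (mu : complex_measure (torus d R) R) : \bar R :=
  W1 (cdensity (lebesgue_torus d R) p) mu.

(* Main.v *)
Require Import Defs.
From mathcomp Require Import all_boot all_order all_algebra.
From mathcomp Require Import all_classical all_reals all_analysis.
From mathcomp Require Import complex measurable_realfun ring lra zify.

Import Order.TTheory GRing.Theory Num.Theory.
Import numFieldNormedType.Exports.
Local Open Scope classical_set_scope.
Local Open Scope ring_scope.

(* Moving the convolution onto the test function turns W1 (J * mu) mu into the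
   supremum of |int h d mu| with h y = int (f x - f y) J (x - y) dx, which is at
   most sup |h| * ||mu||_TV.  As J is an even probability density of product form,
   |h| <= d * int |t| J1 t dt with |t| the distance to the integers, and the task is
   to bound a one-dimensional first moment by 3 / (4 m).  Jordan's inequality
   gives |t| <= |sin (pi t)| / 2 <= 1 / (4 m) + (m / 4) sin (pi t) ^ 2.  Finally
   J1 = 3 / (m (2 m^2 + 1)) F^2 where F is the Fejer kernel,
   int F = m, int F^2 = m (2 m^2 + 1) / 3, and
   sin (pi t) ^ 2 F^2 = sin (m pi t) ^ 2 F <= F.

   Integrals against a charge are handled through the sums
   sum_k v_k nu (f^-1 [v_k, v_k + 1 / N)), which are linear in nu and are
   bounded by the total variation straight from its definition. *)

Set Implicit Arguments.
Unset Strict Implicit.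
Unset Printing Implicit Defensive.

(** * Integration against charges *)

Section charge_integral_approximation.
Context d (T : measurableType d) (R : realType).
Implicit Types (nu : {charge set T -> \bar R}) (mu : {finite_measure set T -> \bar R}).
Implicit Types (f g : T -> R) (B : R) (N k : nat).

(** Opens the chosen Hahn decomposition once; later arguments use only some pair of finite measures
    whose difference is nu and which computes the integral. *)
Lemma charge_integral_jordan nu :
  exists P N : {finite_measure set T -> \bar R},
    (forall A, measurable A -> nu A = (P A - N A)%E) /\
    (forall f, charge_integral nu f = (\int[P]_x f x - \int[N]_x f x)%R).
Proof.
rewrite /charge_integral; case: cid => P /= exN; case: cid => N /= PN.
exists (jordan_pos PN), (jordan_neg PN); split => // A mA.
rewrite [LHS](jordan_decomp PN)//= /cadd/=; congr (_ + _)%E.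
by rewrite cscaleN1.
Qed.

Lemma bounded_measurable_integrable mu f B : measurable_fun setT f ->
  (forall x, `|f x| <= B) -> mu.-integrable setT (EFin \o f).
Proof.
move=> mf fB; apply: measurable_bounded_integrable => //.
  by rewrite -ge0_fin_numE ?fin_num_measure.
exists B; split; first exact: num_real.
by move=> M BM x _ /=; rewrite (le_trans (fB x))// ltW.
Qed.

Lemma Rintegral_sum (mu : {measure set T -> \bar R}) n (F : nat -> T -> R) :
  (forall i, mu.-integrable setT (EFin \o F i)) ->
  (\int[mu]_x (\sum_(i < n) F i x) = \sum_(i < n) \int[mu]_x F i x)%R.
Proof.
move=> iF; elim: n => [|n ih].
  under eq_Rintegral do rewrite big_ord0.
  by rewrite big_ord0 Rintegral_cst// mul0r.
under eq_Rintegral do rewrite big_ord_recr/=.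
rewrite big_ord_recr/= -ih RintegralD//.
have := @integrable_sum _ _ _ mu setT measurableT _ (index_enum 'I_n) xpredT
  (fun i x => (F i x)%:E) (fun i _ => iF i).
by under eq_fun do rewrite sumEFin.
Qed.

(** [Num.trunc] sends negative reals to 0, so these sets partition T for every f. When |f| <= B,
    level k is the slice where f lies in [v_k, v_k + 1/(N+1)), with v_k the [level_value]. *)
Definition level_set f B N k : set T :=
  [set x | Num.trunc (N.+1%:R * (f x + B)) = k].

Definition level_value B N k : R := k%:R / N.+1%:R - B.

(** For |f| <= B the quantity f + B is at most 2B, so no index beyond the truncation of (N+1) 2B
    occurs; the successor counts index 0. *)
Definition level_count B N : nat := (Num.trunc (N.+1%:R * (B + B))).+1.

Definition step_fun f B N (x : T) : R :=
  \sum_(k < level_count B N) level_value B N k * \1_(level_set f B N k) x.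

Definition step_integral nu f B N : R :=
  \sum_(k < level_count B N)
    level_value B N k * fine (nu (level_set f B N k)).

Lemma trivIset_level_set f B N : trivIset setT (level_set f B N).
Proof. by move=> i j _ _ [x [<- <-]]. Qed.

Lemma bigcup_level_set f B N : \bigcup_k level_set f B N k = setT.
Proof. by apply/seteqP; split => // x _; eexists. Qed.

Lemma measurable_level_set f B N k : measurable_fun setT f ->
  measurable (level_set f B N k).
Proof.
move=> mf; pose g x := N.+1%:R * (f x + B).
have mg : measurable_fun setT g.
  by apply: measurable_funM => //; exact: measurable_funD.
rewrite -[level_set _ _ _ _]setTI.
(* Level 0 is a whole half-line, because negative arguments truncate to 0; every other level is a
   half-open unit interval. *)
rewrite (_ : _ `&` _ = (setT `&`
  g @^-1` (if k is 0%N then `]-oo, 1[ else `[k%:R, k.+1%:R[)%classic)).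
  by case: (k) => [|?]; exact: mg.
rewrite !setTI; apply/seteqP; split => x; rewrite /level_set /= -/(g x).
  case: k => [/truncn0Pn|k tk]; first by rewrite -ltNge /= in_itv.
  have g1 : 1 <= g x by rewrite -truncn_gt0 tk.
  by have := truncn_itv (le_trans ler01 g1); rewrite tk /= in_itv.
case: k => [|k]; rewrite /= in_itv/=.
  by move=> g1; apply/truncn0Pn; rewrite -ltNge.
exact: truncn_def.
Qed.

Lemma step_funE f B N x : (forall x, `|f x| <= B) ->
  step_fun f B N x = level_value B N (Num.trunc (N.+1%:R * (f x + B))).
Proof.
move=> fB; set j := Num.trunc _.
have jK : (j < level_count B N)%N.
  rewrite ltnS; apply: le_truncn; rewrite ler_pM2l ?ltr0n// lerD2r.
  exact: le_trans (ler_norm _) (fB x).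
rewrite /step_fun (bigD1 (Ordinal jK))//= big1 => [|i ij].
  by rewrite addr0 indicE mem_set// mulr1.
rewrite indicE memNset ?mulr0// => /esym ji.
by move/eqP : ij; apply; exact: val_inj.
Qed.

Lemma step_fun_dist f B N x : (forall x, `|f x| <= B) ->
  `|f x - step_fun f B N x| <= N.+1%:R^-1.
Proof.
move=> fB; rewrite step_funE// /level_value.
have N0 : 0 < N.+1%:R :> R by rewrite ltr0n.
have : 0 <= N.+1%:R * (f x + B).
  by rewrite mulr_ge0//; have := fB x; rewrite ler_norml => /andP[]; lra.
move/truncn_itv; set j := Num.trunc _ => /andP[j1]; rewrite -[j.+1%:R]natr1 => j2.
have -> : f x - (j%:R / N.+1%:R - B) =
    (N.+1%:R * (f x + B) - j%:R) / N.+1%:R by field; rewrite gt_eqF.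
rewrite normrM [X in _ * X]gtr0_norm ?invr_gt0// ger0_norm; last by lra.
by rewrite ler_piMl ?invr_ge0//; lra.
Qed.

(** Covers the indices whose slice is empty as well, since step sums run over all k below
    [level_count]. *)
Lemma level_value_norm B N k : 0 <= B -> (k < level_count B N)%N ->
  `|level_value B N k| <= B.
Proof.
move=> B0; have N0 : 0 < N.+1%:R :> R by rewrite ltr0n.
rewrite ltnS truncn_ge_nat; last by rewrite mulr_ge0// addr_ge0.
move=> kB; rewrite /level_value ler_norml.
have : 0 <= k%:R / N.+1%:R :> R by rewrite divr_ge0.
have : k%:R / N.+1%:R <= B + B by rewrite ler_pdivrMr// mulrC.
set q := _ / _ => qB q0.
by apply/andP; split; lra.
Qed.

Lemma measurable_step_fun f B N : measurable_fun setT f ->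
  measurable_fun setT (step_fun f B N).
Proof.
move=> mf; apply: measurable_sum => k.
apply: measurable_funM => //; apply: measurable_indic; exact: measurable_level_set.
Qed.

Lemma step_fun_norm f B N x : (forall x, `|f x| <= B) ->
  `|step_fun f B N x| <= B.
Proof.
move=> fB; have B0 : 0 <= B by exact: le_trans (fB x).
rewrite step_funE// level_value_norm//.
rewrite ltnS; apply: le_truncn; rewrite ler_pM2l ?ltr0n// lerD2r.
exact: le_trans (ler_norm _) (fB x).
Qed.

Lemma Rintegral_step_fun mu f B N : measurable_fun setT f ->
  (\int[mu]_x step_fun f B N x =
   \sum_(k < level_count B N) level_value B N k * fine (mu (level_set f B N k)))%R.
Proof.
move=> mf; have mL k := measurable_level_set B N k mf.
rewrite (@Rintegral_sum mu _ (fun k x => level_value B N k * \1_(level_set f B N k) x)).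
  apply: eq_bigr => k _; rewrite RintegralZl//; last exact: integrable_indic.
  by rewrite /Rintegral integral_indic// setIT.
move=> k; apply: (@bounded_measurable_integrable _ _ `|level_value B N k|).
  by apply: measurable_funM => //; exact: measurable_indic.
by move=> x; rewrite normrM ler_piMr// indicE; case: (_ \in _); rewrite ?normr1 ?normr0.
Qed.

Lemma Rintegral_step_fun_dist mu f B N : measurable_fun setT f ->
  (forall x, `|f x| <= B) ->
  `|(\int[mu]_x f x)%R - (\int[mu]_x step_fun f B N x)%R| <=
  fine (mu setT) / N.+1%:R.
Proof.
move=> mf fB.
have ms := measurable_step_fun B N mf.
have if_ : mu.-integrable setT (EFin \o f) by exact: bounded_measurable_integrable fB.
have is_ : mu.-integrable setT (EFin \o step_fun f B N).
  by apply: bounded_measurable_integrable ms _ => x; exact: step_fun_norm.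
rewrite -RintegralB//; apply: le_trans (le_normr_Rintegral _ _) _ => //.
  by rewrite (_ : _ \o _ = (EFin \o f) \- (EFin \o step_fun f B N))%E; [exact: integrableB|].
rewrite mulrC -Rintegral_cst//; apply: le_Rintegral => //.
- apply: (@bounded_measurable_integrable _ _ N.+1%:R^-1).
    by apply: measurableT_comp => //; exact: measurable_funB.
  by move=> x; rewrite normr_id step_fun_dist.
- by apply: (@bounded_measurable_integrable _ _ `|N.+1%:R^-1|).
- by move=> x _; exact: step_fun_dist.
Qed.

(** The step function is within 1/(N+1) of f, so C can be the total mass of the Jordan pair. It
    depends on nu alone, and letting N grow determines the integral from values of nu on level
    sets. *)
Lemma charge_integral_approx nu : exists C, forall f B N,
  measurable_fun setT f -> (forall x, `|f x| <= B) ->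
  `|charge_integral nu f - step_integral nu f B N| <= C / N.+1%:R.
Proof.
have [P [M [nuPM nuE]]] := charge_integral_jordan nu.
exists (fine (P setT) + fine (M setT)) => f B N mf fB.
have -> : step_integral nu f B N =
    (\int[P]_x step_fun f B N x - \int[M]_x step_fun f B N x)%R.
  rewrite !Rintegral_step_fun// -sumrB; apply: eq_bigr => k _.
  have mL := measurable_level_set B N k mf.
  by rewrite -mulrBr nuPM// fineB// fin_num_measure.
rewrite nuE [X in `|X|](_ : _ =
  (\int[P]_x f x - \int[P]_x step_fun f B N x) -
  (\int[M]_x f x - \int[M]_x step_fun f B N x))%R; last by ring.
by rewrite mulrDl; apply: (le_trans (ler_normB _ _)); apply: lerD;
  exact: Rintegral_step_fun_dist.
Qed.

End charge_integral_approximation.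

(** * Linearity in the charge, densities, and the total variation bound *)

Section charge_integral_theory.
Context d (T : measurableType d) (R : realType).
Implicit Types (nu : {charge set T -> \bar R}) (f g : T -> R) (B : R).

Lemma le_of_approx (a b C : R) :
  (forall N, a <= b + C / N.+1%:R) -> a <= b.
Proof.
move=> abC; rewrite leNgt; apply/negP => ba.
have ab0 : 0 < a - b by rewrite subr_gt0.
have [N CN] : exists N, C / (a - b) < N.+1%:R.
  by exists (Num.trunc (C / (a - b))); exact: truncnS_gt.
have N0 : 0 < N.+1%:R :> R by rewrite ltr0n.
have := abC N; apply/negP; rewrite -ltNge -ltrBrDl.
by rewrite ltr_pdivrMr// mulrC -ltr_pdivrMr.
Qed.

(** Identifies a charge integral as the limit of its step sums. This avoids computing the Jordan
    decomposition of a difference of charges or of a density. *)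
Lemma charge_integral_unique nu f B (l C : R) : measurable_fun setT f ->
  (forall x, `|f x| <= B) ->
  (forall N, `|l - step_integral nu f B N| <= C / N.+1%:R) ->
  charge_integral nu f = l.
Proof.
move=> mf fB lC; have [C' fC'] := charge_integral_approx nu.
apply/eqP; rewrite -subr_eq0 -normr_le0; apply: (@le_of_approx _ _ (C + C')) => N.
rewrite add0r mulrDl -(subrKA (step_integral nu f B N)) addrC.
by apply: (le_trans (ler_normD _ _)); apply: lerD;
  [rewrite distrC; exact: lC|exact: fC'].
Qed.

(** Jordan parts do not subtract when charges do, but step sums are linear in the charge. *)
Lemma charge_integral_caddN (nu1 nu2 : {charge set T -> \bar R}) f B :
  measurable_fun setT f -> (forall x, `|f x| <= B) ->
  charge_integral (cadd nu1 (copp nu2)) f =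
  charge_integral nu1 f - charge_integral nu2 f.
Proof.
move=> mf fB.
have [C1 fC1] := charge_integral_approx nu1.
have [C2 fC2] := charge_integral_approx nu2.
apply: (@charge_integral_unique _ _ B _ (C1 + C2)) => // N.
have -> : step_integral (cadd nu1 (copp nu2)) f B N =
    step_integral nu1 f B N - step_integral nu2 f B N.
  rewrite -sumrB; apply: eq_bigr => k _; rewrite -mulrBr; congr (_ * _).
  have mL := measurable_level_set B N k mf.
  by rewrite /cadd/= /copp fineD ?fin_numN ?fin_num_measure// fineN.
rewrite mulrDl [X in `|X|](_ : _ =
  (charge_integral nu1 f - step_integral nu1 f B N) -
  (charge_integral nu2 f - step_integral nu2 f B N)); last by ring.
by apply: (le_trans (ler_normB _ _)); apply: lerD; [exact: fC1|exact: fC2].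
Qed.

(** A step sum of the density is the mu-integral of the step function times g, which differs from
    that of f times g by at most mu(T) M / (N+1). *)
Lemma charge_integral_density (mu : {finite_measure set T -> \bar R}) f g B M :
  measurable_fun setT f -> (forall x, `|f x| <= B) ->
  measurable_fun setT g -> (forall x, `|g x| <= M) ->
  charge_integral (charge_density mu g) f = (\int[mu]_x (f x * g x))%R.
Proof.
move=> mf fB mg gM; have ig := bounded_measurable_integrable mu mg gM.
have ibg (h : T -> R) c : measurable_fun setT h -> (forall x, `|h x| <= c) ->
    mu.-integrable setT (EFin \o (fun x => h x * g x)).
  move=> mh hc; apply: (@bounded_measurable_integrable _ _ _ _ _ (c * M)).
    exact: measurable_funM.
  by move=> x; rewrite normrM ler_pM.
(* A bounded measurable g is integrable for the finite measure mu, so the default [czero] is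
   excluded. *)
rewrite /charge_density; case: pselect => // intg.
apply: (@charge_integral_unique _ _ B _ (fine (mu setT) * M)) => // N.
have ms := measurable_step_fun B N mf.
have -> : step_integral (induced_charge intg) f B N =
    (\int[mu]_x (step_fun f B N x * g x))%R.
  have mL k := measurable_level_set B N k mf.
  transitivity (\int[mu]_x (\sum_(k < level_count B N)
    (level_value B N k * (\1_(level_set f B N k) x * g x))))%R; last first.
    apply: eq_Rintegral => x _; rewrite mulr_suml.
    by apply: eq_bigr => k _; rewrite mulrA.
  have iL k : mu.-integrable setT (EFin \o (fun x => \1_(level_set f B N k) x * g x)).
    apply: (ibg _ 1); first exact: measurable_indic.
    by move=> x; rewrite indicE; case: (_ \in _); rewrite ?normr1 ?normr0.
  rewrite (@Rintegral_sum _ _ _ mu _ (fun k x =>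
    level_value B N k * (\1_(level_set f B N k) x * g x))).
    apply: eq_bigr => k _; rewrite RintegralZl//; congr (_ * _).
    rewrite /induced_charge/= -/(Rintegral mu (level_set f B N k) g) Rintegral_mkcond.
    apply: eq_Rintegral => x _; rewrite patchE indicE.
    by case: (x \in _); rewrite ?mul1r ?mul0r.
  move=> k; under eq_fun do rewrite mulrA.
  apply: (ibg (fun x => level_value B N k * \1_(level_set f B N k) x) `|level_value B N k|).
    by apply: measurable_funM => //; exact: measurable_indic.
  by move=> x; rewrite normrM ler_piMr// indicE; case: (_ \in _); rewrite ?normr1 ?normr0.
have is_ := ibg _ _ ms (fun x => step_fun_norm N x fB).
have if_ := ibg _ _ mf fB.
rewrite -RintegralB//; apply: le_trans (le_normr_Rintegral _ _) _ => //.
  by rewrite (_ : _ \o _ = (EFin \o (fun x => f x * g x)%R) \-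
    (EFin \o (fun x => step_fun f B N x * g x)%R))%E; [exact: integrableB|].
rewrite -mulrA mulrC -Rintegral_cst//; apply: le_Rintegral => //.
- apply: (@bounded_measurable_integrable _ _ _ _ _ (B * M + B * M)).
    apply: measurableT_comp => //; apply: measurable_funB; exact: measurable_funM.
  move=> x; rewrite normr_id (le_trans (ler_normB _ _))// !normrM.
  by rewrite lerD// ler_pM// step_fun_norm.
- exact: (@bounded_measurable_integrable _ _ _ _ _ `|M / N.+1%:R|).
- move=> x _ /=; rewrite -mulrBl normrM mulrC ler_pM//.
  exact: step_fun_dist.
Qed.

(** Real and imaginary sums stay separate because step sums of [re_part] and [im_part] appear so;
    recombining them before taking norms keeps the total variation constant sharp. *)
Lemma le_normc_sum n (v : nat -> R) (z : nat -> R[i]) :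
  Normc.normc ((\sum_(k < n) v k * complex.Re (z k)) +i*
    (\sum_(k < n) v k * complex.Im (z k)))%C <=
  \sum_(k < n) `|v k| * Normc.normc (z k).
Proof.
elim: n => [|n ih]; first by rewrite !big_ord0 Normc.normc0.
rewrite !big_ord_recr/=.
apply: le_trans (lerD ih (lexx _)).
have -> : `|v n| * Normc.normc (z n) = Normc.normc ((v n)%:C%C * z n).
  by rewrite Normc.normcM /= expr0n addr0 sqrtr_sqr.
case: (z n) => a b /=; rewrite !mul0r subr0 addr0.
exact: (le_normcD (_ +i* _)%C (_ +i* _)%C).
Qed.

(** A crude bound, applied only to an error that vanishes as N grows. *)
Lemma le_normc_ReIm (a b : R) : Normc.normc (a +i* b)%C <= `|a| + `|b|.
Proof.
rewrite /= -[leRHS]ger0_norm ?addr_ge0// -sqrtr_sqr ler_sqrt ?sqr_ge0//.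
rewrite sqrrD !real_normK ?num_real// addrAC lerDl.
by rewrite mulrn_wge0 ?mulr_ge0.
Qed.

Lemma sum_normc_le_tv_norm (mu : complex_measure T R) (A : (set T)^nat) n :
  (forall k, measurable (A k)) -> trivIset setT A -> \bigcup_k A k = setT ->
  ((\sum_(k < n) Normc.normc (cmeasure mu (A k)))%:E <= tv_norm mu)%E.
Proof.
move=> mA tA UA.
apply: (@le_trans _ _ (\sum_(0 <= k <oo) (Normc.normc (cmeasure mu (A k)))%:E)%E).
  rewrite -sumEFin -(big_mkord xpredT (fun k => (Normc.normc (cmeasure mu (A k)))%:E)).
  by apply: nneseries_lim_ge => k _ _; rewrite lee_fin sqrtr_ge0.
by apply: ereal_sup_ubound; exists A.
Qed.

Lemma tv_norm_ge0 (mu : complex_measure T R) : (0 <= tv_norm mu)%E.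
Proof.
have m0 : measurable_fun setT (fun _ : T => 0 : R) by exact: measurable_cst.
(* Any countable partition serves, here the level sets of the zero function; the partial sum taken
   is empty. *)
have := @sum_normc_le_tv_norm mu _ 0%N (fun k => measurable_level_set 0 0%N k m0)
  (@trivIset_level_set _ _ _ _ _ _) (@bigcup_level_set _ _ _ _ _ _).
by rewrite big_ord0.
Qed.

Lemma le_cintegral_tv_norm (mu : complex_measure T R) f B : 0 <= B ->
  measurable_fun setT f -> (forall x, `|f x| <= B) -> (tv_norm mu < +oo)%E ->
  ((Normc.normc (cintegral mu f))%:E <= B%:E * tv_norm mu)%E.
Proof.
move=> B0 mf fB tvoo.
have sumtv N n := @sum_normc_le_tv_norm mu _ n (fun k => measurable_level_set B N k mf)
  (@trivIset_level_set _ _ _ f B N) (bigcup_level_set f B N).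
have tvfin : tv_norm mu \is a fin_num by rewrite ge0_fin_numE// tv_norm_ge0.
rewrite -(fineK tvfin) -EFinM lee_fin.
have [C1 fC1] := charge_integral_approx (re_part mu).
have [C2 fC2] := charge_integral_approx (im_part mu).
apply: (@le_of_approx _ _ (C1 + C2)) => N.
pose s1 := step_integral (re_part mu) f B N.
pose s2 := step_integral (im_part mu) f B N.
have -> : cintegral mu f = (s1 +i* s2)%C +
   ((charge_integral (re_part mu) f - s1) +i* (charge_integral (im_part mu) f - s2))%C.
  rewrite /cintegral; apply/eqP; rewrite eq_complex/=.
  by rewrite [X in _ == X]addrC subrK [X in _ && (_ == X)]addrC subrK !eqxx.
apply: (le_trans (le_normcD _ _)); apply: lerD; last first.
  apply: (le_trans (le_normc_ReIm _ _)); rewrite mulrDl; apply: lerD.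
    exact: fC1.
  exact: fC2.
have := le_normc_sum (level_count B N) (level_value B N)
  (fun k => cmeasure mu (level_set f B N k)).
move=> /le_trans; apply.
apply: (@le_trans _ _ (\sum_(k < level_count B N)
  B * Normc.normc (cmeasure mu (level_set f B N k)))).
  by apply: ler_sum => k _; rewrite ler_wpM2r ?sqrtr_ge0// level_value_norm.
by rewrite -mulr_sumr ler_wpM2l// -lee_fin fineK.
Qed.

End charge_integral_theory.

(** * Fubini for a finite measure and a charge *)

Section charge_fubini.
Context d1 d2 (T1 : measurableType d1) (T2 : measurableType d2) (R : realType).

Section measure_fubini.
Variables (m1 : {finite_measure set T1 -> \bar R}) (m2 : {finite_measure set T2 -> \bar R}).
Variables (k : T1 * T2 -> R) (M : R).
Hypotheses (mk : measurable_fun setT k) (kM : forall z, `|k z| <= M).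

Lemma bounded_integrable_prod : (m1 \x m2)%E.-integrable setT (EFin \o k).
Proof.
apply/integrable12ltyP; first exact/measurable_EFinP.
apply: (@le_lt_trans _ _ (\int[m1]_x \int[m2]_y M%:E)%E); last first.
  under eq_integral do rewrite integral_cst//.
  rewrite integral_cst//=.
  rewrite -(fineK (fin_num_measure m2 _ measurableT)).
  by rewrite -(fineK (fin_num_measure m1 _ measurableT)) -!EFinM ltry.
apply: ge0_le_integral => //.
- by move=> x _; exact: integral_ge0.
- apply: (measurable_fun_fubini_tonelli_F (abse \o (EFin \o k))) => //=.
  by apply: measurableT_comp => //; exact/measurable_EFinP.
- move=> x _; apply: ge0_le_integral => //.
  + apply: measurableT_comp => //; apply/measurable_EFinP.
    exact: (measurableT_comp mk).
  + by move=> y _; rewrite lee_fin; exact: kM.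
Qed.

Lemma measurable_Rintegral1 : measurable_fun setT (fun x => \int[m2]_y k (x, y))%R.
Proof.
apply: measurableT_comp => //.
exact: (measurable_fubini_F bounded_integrable_prod).
Qed.

Lemma measurable_Rintegral2 : measurable_fun setT (fun y => \int[m1]_x k (x, y))%R.
Proof.
apply: measurableT_comp => //.
exact: (measurable_fubini_G bounded_integrable_prod).
Qed.

Lemma measurable_prod1 x : measurable_fun setT (fun y => k (x, y)).
Proof. exact: (measurableT_comp mk). Qed.

Lemma measurable_prod2 y : measurable_fun setT (fun x => k (x, y)).
Proof. exact: (measurableT_comp mk). Qed.

Lemma Rintegral_fubini :
  (\int[m1]_x (\int[m2]_y k (x, y)) = \int[m2]_y (\int[m1]_x k (x, y)))%R.
Proof.
rewrite /Rintegral; congr fine.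
transitivity (\int[m1]_x \int[m2]_y (k (x, y))%:E)%E.
  apply: eq_integral => x _; rewrite fineK//; apply: integrable_fin_num => //.
  by apply: (bounded_measurable_integrable _ (measurable_prod1 x)) => y; exact: kM.
rewrite (Fubini bounded_integrable_prod).
apply: eq_integral => y _; rewrite fineK//; apply: integrable_fin_num => //.
by apply: (bounded_measurable_integrable _ (measurable_prod2 y)) => x; exact: kM.
Qed.

End measure_fubini.

Lemma charge_integralB d (T : measurableType d) (nu : {charge set T -> \bar R})
    (f g : T -> R) (A B : R) :
  measurable_fun setT f -> (forall x, `|f x| <= A) ->
  measurable_fun setT g -> (forall x, `|g x| <= B) ->
  charge_integral nu (fun x => f x - g x) =
  charge_integral nu f - charge_integral nu g.
Proof.
move=> mf fA mg gB; have [P [N [_ nuE]]] := charge_integral_jordan nu.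
rewrite !nuE; rewrite !RintegralB//; first by ring.
all: by [exact: bounded_measurable_integrable fA|exact: bounded_measurable_integrable gB].
Qed.

Variables (lam : {finite_measure set T1 -> \bar R}) (nu : {charge set T2 -> \bar R}).
Variables (k : T1 * T2 -> R) (M : R).
Hypotheses (mk : measurable_fun setT k) (kM : forall z, `|k z| <= M).

Lemma Rintegral_norm_le d (T : measurableType d) (mu : {finite_measure set T -> \bar R})
    (f : T -> R) (B : R) :
  measurable_fun setT f -> (forall x, `|f x| <= B) ->
  `|\int[mu]_x f x|%R <= B * fine (mu setT).
Proof.
move=> mf fB; have if_ := bounded_measurable_integrable mu mf fB.
apply: (le_trans (le_normr_Rintegral _ _)) => //.
rewrite -Rintegral_cst//; apply: le_Rintegral => //.
  apply: (@bounded_measurable_integrable _ _ _ _ _ B).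
    exact: measurableT_comp.
  by move=> x; rewrite normr_id.
exact: (@bounded_measurable_integrable _ _ _ _ _ `|B|).
Qed.

Lemma measurable_charge_integral :
  measurable_fun setT (fun x => charge_integral nu (fun y => k (x, y))).
Proof.
have [P [N [_ nuE]]] := charge_integral_jordan nu.
under eq_fun do rewrite nuE.
by apply: measurable_funB; exact: (measurable_Rintegral1 lam _ mk kM).
Qed.

Lemma charge_integral_bounded :
  exists C, forall x, `|charge_integral nu (fun y => k (x, y))| <= C.
Proof.
have [P [N [_ nuE]]] := charge_integral_jordan nu.
exists (M * fine (P setT) + M * fine (N setT)) => x; rewrite nuE.
by apply: (le_trans (ler_normB _ _)); apply: lerD;
  apply: Rintegral_norm_le => //; exact: measurable_prod1.
Qed.

(** The Jordan pair reduces this to two exchanges between finite measures, for the bounded kernel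
    f(x) k(x, y). It is what moves the convolution onto the test function. *)
Lemma charge_integral_fubini (f : T1 -> R) (B : R) :
  measurable_fun setT f -> (forall x, `|f x| <= B) ->
  (\int[lam]_x (f x * charge_integral nu (fun y => k (x, y))))%R =
  charge_integral nu (fun y => \int[lam]_x (f x * k (x, y)))%R.
Proof.
move=> mf fB; have [P [N [_ nuE]]] := charge_integral_jordan nu.
rewrite nuE; under eq_Rintegral do rewrite nuE mulrBr.
pose fk z := f z.1 * k z.
have mfk : measurable_fun setT fk.
  by apply: measurable_funM => //; exact: measurableT_comp.
have fkBM z : `|fk z| <= B * M by rewrite normrM ler_pM.
have fi (m : {finite_measure set T2 -> \bar R}) x :
    (f x * \int[m]_y k (x, y) = \int[m]_y fk (x, y))%R.
  rewrite -RintegralZl//.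
  apply: (bounded_measurable_integrable _ (measurable_prod1 mk x)) => y; exact: kM.
under eq_Rintegral do rewrite !fi.
rewrite RintegralB//; first by rewrite !(Rintegral_fubini _ _ mfk fkBM).
all: apply: (@bounded_measurable_integrable _ _ _ _ _ (B * M * _)).
all: try by apply: measurable_Rintegral1 mfk fkBM.
all: by move=> x; apply: Rintegral_norm_le => //; exact: measurable_prod1.
Qed.

End charge_fubini.

(** * The one-dimensional Jackson kernel *)

Section dirichlet_fejer.
Context {R : realType}.
Implicit Types (x : R) (m j k : nat).

Definition harmonic_cos k x : R := cos (k%:R * (pi *+ 2 * x)).

Definition dirichlet j x : R := 1 + 2 * \sum_(k < j) harmonic_cos k.+1 x.

(** Unnormalised: the sum, not the average, of the first m Dirichlet kernels. *)
Definition fejer m x : R := \sum_(j < m) dirichlet j x.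

Lemma mul_cos_sin (a b : R) : 2 * cos a * sin b = sin (a + b) - sin (a - b).
Proof. by rewrite sinD sinB; ring. Qed.

Lemma mul_cos_cos (a b : R) : 2 * (cos a * cos b) = cos (a + b) + cos (a - b).
Proof. by rewrite cosD cosB; ring. Qed.

Lemma mul_sin_sin (a b : R) :
  sin (a + b) * sin (a - b) = sin a ^+ 2 - sin b ^+ 2.
Proof. 
have ca := cos2sin2 a; have cb := cos2sin2 b.
rewrite sinD sinB.
have -> : (sin a * cos b + cos a * sin b) * (sin a * cos b - cos a * sin b) =
  sin a ^+ 2 * cos b ^+ 2 - cos a ^+ 2 * sin b ^+ 2 by ring.
by rewrite ca cb; ring.
 Qed.

Lemma sin_neq0 (t : R) : t != 0 -> `|t| < 2 -> sin t != 0.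
Proof.
rewrite neq_lt => /orP[t0|t0]; rewrite ltr_norml => /andP[t2N t2].
  by rewrite -oppr_eq0 -sinN gt_eqF// sin2_gt0// oppr_gt0 t0 ltrNl.
by rewrite gt_eqF// sin2_gt0// t0.
Qed.

(** Telescoping: 2 cos(2 pi k x) sin(pi x) = sin((2k+1) pi x) - sin((2k-1) pi x). *)
Lemma dirichletE j x :
  dirichlet j x * sin (pi * x) = sin ((j.*2.+1)%:R * (pi * x)).
Proof.
rewrite /dirichlet; elim: j => [|j ih]; first by rewrite big_ord0 mulr0 addr0 !mul1r.
rewrite big_ord_recr/= mulrDr addrA mulrDl ih mul_cos_sin.
rewrite (_ : _ + pi * x = j.+1.*2.+1%:R * (pi * x)); last first.
  by rewrite -!muln2 -!natr1 !natrM -!natr1; ring.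
rewrite (_ : _ - pi * x = j.*2.+1%:R * (pi * x)); last first.
  by rewrite -!muln2 -!natr1 !natrM -!natr1; ring.
by rewrite addrC subrK.
Qed.

(** Telescoping again: the term D_m sin(pi x)^2 is sin((2m+1) pi x) sin(pi x), the difference of the
    squared sines at (m+1) pi x and m pi x. Without division the identity also covers integer x. *)
Lemma fejerE m x : fejer m x * sin (pi * x) ^+ 2 = sin (m%:R * pi * x) ^+ 2.
Proof.
rewrite /fejer; elim: m => [|m ih].
  by rewrite big_ord0 !mul0r sin0 expr0n.
rewrite big_ord_recr/= mulrDl ih expr2 mulrA dirichletE.
have -> : m.*2.+1%:R * (pi * x) = m.+1%:R * pi * x + m%:R * pi * x.
  by rewrite -muln2 -!natr1 natrM; ring.
rewrite (_ : pi * x = m.+1%:R * pi * x - m%:R * pi * x); last first.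
  by rewrite -natr1; ring.
by rewrite mul_sin_sin; ring.
Qed.

Lemma continuous_harmonic_cos k : continuous (harmonic_cos k).
Proof.
move=> x; apply: (@continuous_comp _ _ _ (fun x => k%:R * (pi *+ 2 * x)) cos).
  by apply: cvgMr; apply: cvgMr; exact: cvg_id.
exact: continuous_cos.
Qed.

Lemma continuous_sumr (n : nat) (F : nat -> R -> R) :
  (forall i, continuous (F i)) -> continuous (fun x => \sum_(i < n) F i x).
Proof. by move=> cF; apply: continuous_big => // x; exact: add_continuous. Qed.

Lemma continuous_dirichlet j : continuous (dirichlet j).
Proof.
move=> x; apply: cvgD; first exact: cvg_cst.
apply: cvgMr.
exact: (@continuous_sumr j (fun k => harmonic_cos k.+1) (fun k => @continuous_harmonic_cos _)) x.
Qed.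

Lemma continuous_fejer m : continuous (fejer m).
Proof. exact: continuous_sumr continuous_dirichlet. Qed.

Definition jackson_const m : R := 3 / (m%:R * (2 * m%:R ^+ 2 + 1)).

Lemma jackson_quotient_fejer m x : sin (pi * x) != 0 ->
  jackson_quotient m x = jackson_const m * fejer m x ^+ 2.
Proof.
move=> s0; rewrite /jackson_quotient -/(jackson_const m); congr (_ * _).
by rewrite -[4%N]/(2 * 2)%N exprM -fejerE; field.
Qed.

(** At an integer, [jackson1] is a punctured limit. The quotient agrees nearby with a continuous
    trigonometric polynomial, whose value is therefore the limit. *)
Lemma jackson1_fejer m x : jackson1 m x = jackson_const m * fejer m x ^+ 2.
Proof.
rewrite /jackson1; case: ifPn => [/eqP s0|]; last exact: jackson_quotient_fejer.
apply/cvg_lim => //.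
have cont : jackson_const m * fejer m y ^+ 2 @[y --> x^'] -->
    jackson_const m * fejer m x ^+ 2.
  apply: cvg_within_filter; apply: cvgMr.
  apply: (@continuous_comp _ _ _ (fejer m) (fun y => y ^+ 2)).
    exact: continuous_fejer.
  exact: exprn_continuous.
apply: cvg_trans cont; apply: near_eq_cvg.
(* Zeros of sin(pi y) are isolated: at a zero x, sin(pi y) = cos(pi x) sin(pi (y - x)) with |cos(pi
   x)| = 1, and the radius 2 / pi keeps |pi (y - x)| below 2, hence below pi. *)
have sx : \forall y \near x, y != x -> sin (pi * y) != 0.
  near=> y => yx.
  have -> : sin (pi * y) = cos (pi * x) * sin (pi * (y - x)).
    by rewrite [in LHS](_ : pi * y = pi * x + pi * (y - x)) ?sinD ?s0; ring.
  rewrite mulf_neq0//; first by rewrite -normr_eq0 (sin0cos1 s0) oner_eq0.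
  apply: sin_neq0; first by rewrite mulf_neq0 ?subr_eq0// gt_eqF// pi_gt0.
  rewrite normrM gtr0_norm ?pi_gt0// mulrC -ltr_pdivlMr ?pi_gt0//.
  near: y; exists (2 / pi); first by rewrite /= divr_gt0 ?pi_gt0.
  by move=> z /=; rewrite distrC.
near=> y.
rewrite jackson_quotient_fejer//; near: y; exact: sx.
Unshelve. all: by end_near.
Qed.

End dirichlet_fejer.

(** * Means over the circle of harmonics, Dirichlet and Fejer kernels *)

Section circle_integral.
Context {R : realType}.
Local Notation mu := (@lebesgue_measure R).
Local Notation circ := (@lebesgue_circle R).
Implicit Types (g : R -> R).

Lemma measurable_circle_val : measurable_fun setT (val : circle R -> R).
Proof. by move=> _ B mB; exists B. Qed.

Lemma continuous_bounded_itv g (a b : R) : a <= b -> continuous g ->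
  exists M, forall t, a <= t <= b -> `|g t| <= M.
Proof.
move=> ab cg.
have cng : {within `[a, b], continuous (fun t => `|g t|)}.
  apply: continuous_subspaceT => x; apply: continuous_comp; first exact: cg.
  exact: norm_continuous.
have [c _ cM] := EVT_max ab cng.
by exists `|g c| => t tab; apply: cM; rewrite in_itv.
Qed.

Lemma integrable_circle g : continuous g ->
  circ.-integrable setT (EFin \o (g \o val)).
Proof.
move=> cg; apply: measurable_bounded_integrable => //.
- by rewrite -ge0_fin_numE ?fin_num_measure.
- apply: measurableT_comp; last exact: measurable_circle_val.
  exact: continuous_measurable_fun.
- have [M gM] := continuous_bounded_itv ler01 cg.
  exists M; split; first exact: num_real.
  move=> M' MM' [t t01] _ /=; rewrite (le_trans _ (ltW MM'))//.
  by apply: gM; case/andP: t01 => -> /ltW.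
Qed.

(** Pushing [lebesgue_circle] forward along [val] gives Lebesgue measure on [0, 1); the endpoint 1
    is null and is added so that the fundamental theorem of calculus applies. *)
Lemma Rintegral_circle g : continuous g ->
  (\int[circ]_x g (val x) = \int[mu]_(x in `[0, 1]) g x)%R.
Proof.
move=> cg.
have vT : (val : circle R -> R) @^-1` `[0, 1[%classic = setT.
  by apply/seteqP; split => // -[t t01] _; rewrite /= in_itv.
rewrite -Rintegral_itv_bndo_bndc; last first.
  apply: (@integrableS _ _ _ mu `[0, 1]) => //.
    by apply: subset_itvl; rewrite bnd_simp.
  apply: continuous_compact_integrable; first exact: segment_compact.
  exact: continuous_subspaceT.
rewrite /Rintegral; congr fine.
have := @integral_pushforward _ _ (circle R) (measurableTypeR R) R val measurable_circle_val circ
  `[0, 1[%classic (EFin \o g).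
rewrite vT => <-//; last 2 first.
- by apply/measurable_EFinP; exact: continuous_measurable_fun.
- exact: integrable_circle.
apply: eq_measure_integral => [|mval A mA A01]; first exact: measurable_circle_val.
suff vA : [set val x | x in (val : circle R -> R) @^-1` A] = A.
  by rewrite -[in RHS]vA.
apply/seteqP; split => [_ [x Ax <-]//|t At].
have t01 := A01 _ At; rewrite /= in_itv/= in t01.
by exists (exist _ t t01).
Qed.

Lemma Rintegral_circleD {g h} : continuous g -> continuous h ->
  (\int[circ]_x (g (val x) + h (val x)) =
   \int[circ]_x g (val x) + \int[circ]_x h (val x))%R.
Proof. by move=> cg ch; rewrite RintegralD//; exact: integrable_circle. Qed.

Lemma Rintegral_circleZ {g} c : continuous g ->
  (\int[circ]_x (c * g (val x)) = c * \int[circ]_x g (val x))%R.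
Proof. by move=> cg; rewrite RintegralZl//; exact: integrable_circle. Qed.

Lemma Rintegral_circle_sum {n : nat} {F : nat -> R -> R} :
  (forall i, continuous (F i)) ->
  (\int[circ]_x (\sum_(i < n) F i (val x)) =
   \sum_(i < n) \int[circ]_x (F i (val x)))%R.
Proof.
move=> cF; rewrite (@Rintegral_sum _ _ _ circ n (fun i => F i \o val))// => i.
exact: integrable_circle.
Qed.

(** The antiderivative sin(c (x - y)) / c has equal values at 0 and 1, because c is a multiple of 2
    pi; the index k+1 makes c nonzero. *)
Lemma Rintegral_harmonic_cos k y :
  (\int[circ]_x harmonic_cos k.+1 (val x - y) = 0)%R.
Proof.
pose c : R := k.+1%:R * (pi *+ 2).
have c0 : c != 0 by rewrite mulf_neq0 ?pnatr_eq0// mulrn_eq0/= gt_eqF ?pi_gt0.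
pose F (x : R) := sin (c * (x - y)) / c.
have cE x : harmonic_cos k.+1 x = cos (c * x).
  by rewrite /harmonic_cos mulrA.
have sh : continuous (fun x : R => x - y).
  by move=> x; apply: cvgB; [exact: cvg_id|exact: cvg_cst].
have ch : continuous (fun x => harmonic_cos k.+1 (x - y)).
  by move=> x; apply: (@continuous_comp _ _ _ (fun x => x - y));
    [exact: sh|exact: continuous_harmonic_cos].
rewrite (@Rintegral_circle (fun x => harmonic_cos k.+1 (x - y)))//.
have dF (x : R) : is_derive x 1 F (cos (c * (x - y))).
  rewrite /F; apply: is_derive_eq; rewrite !scaler0 ?add0r ?addr0.
  by rewrite subr0 /GRing.scale/= mulr1; field.
have cF : continuous F.
  by move=> x; apply/differentiable_continuous/derivable1_diffP; apply: ex_derive.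
rewrite /Rintegral (@continuous_FTC2 _ _ F)//.
- rewrite /F -EFinB/= [X in X - _](_ : _ = sin (c * (0 - y)) / c) ?subrr//.
  rewrite (_ : c * (1 - y) = c * (0 - y) + pi *+ 2 *+ k.+1); last first.
    by rewrite /c -[in RHS]mulr_natl; ring.
  by rewrite (periodicn (@sinD2pi R)).
- exact: continuous_subspaceT.
- split.
  + by move=> x _; exact: ex_derive.
  + by apply: cvg_at_right_filter; exact: cF.
  + by apply: cvg_at_left_filter; exact: cF.
- by move=> x _; rewrite cE derive1E derive_val.
Qed.

(** Carrying the shift y takes the place of translation invariance: only the harmonics are
    integrated for arbitrary y, and the kernel means below reduce to them. *)
Definition circle_mean (y : R) (g : R -> R) : R :=
  (\int[circ]_x g (val x - y))%R.

Section circle_mean.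
Variable y : R.
Local Notation E := (circle_mean y).

Lemma continuous_shift g : continuous g -> continuous (fun x => g (x - y)).
Proof.
move=> cg x; apply: (@continuous_comp _ _ _ (fun x => x - y)); last exact: cg.
by apply: cvgB; [exact: cvg_id|exact: cvg_cst].
Qed.

Lemma circle_meanD g h : continuous g -> continuous h ->
  E (fun x => g x + h x) = E g + E h.
Proof.
by move=> cg ch; rewrite /circle_mean
  (Rintegral_circleD (g := fun x => g (x - y)) (h := fun x => h (x - y)))//;
  exact: continuous_shift.
Qed.

Lemma circle_meanZ c g : continuous g -> E (fun x => c * g x) = c * E g.
Proof.
by move=> cg; rewrite /circle_mean (Rintegral_circleZ (g := fun x => g (x - y)))//;
  exact: continuous_shift.
Qed.

Lemma circle_mean_sum (n : nat) (F : nat -> R -> R) :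
  (forall i, continuous (F i)) ->
  E (fun x => \sum_(i < n) F i x) = \sum_(i < n) E (F i).
Proof.
by move=> cF; rewrite /circle_mean
  (Rintegral_circle_sum (F := fun i x => F i (x - y)))// => i;
  exact: continuous_shift.
Qed.

Lemma circle_mean_harmonic k : E (harmonic_cos k) = (k == 0)%N%:R.
Proof.
case: k => [|k]; last exact: Rintegral_harmonic_cos.
rewrite /circle_mean; under eq_Rintegral do rewrite /harmonic_cos mul0r cos0.
by rewrite Rintegral_cst//= [X in fine X]probability_setT mulr1.
Qed.

Lemma continuousM_fun g h : continuous g -> continuous h ->
  continuous (fun x => g x * h x).
Proof. by move=> cg ch x; apply: cvgM; [exact: cg|exact: ch]. Qed.

Lemma mul_harmonic_cos (a b : nat) (x : R) :
  2 * (harmonic_cos a x * harmonic_cos b x) =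
  harmonic_cos (a + b) x + harmonic_cos `|a - b|%N x.
Proof.
rewrite mul_cos_cos -mulrDl -natrD; congr (_ + _).
have [ba|ab] := leqP b a.
  by rewrite distnEl// /harmonic_cos natrB// mulrBl.
rewrite distnEr ?(ltnW ab)// /harmonic_cos natrB ?(ltnW ab)//.
by rewrite -cosN; congr cos; ring.
Qed.

Lemma sum_nat_eq (n k : nat) : (\sum_(l < n) (l.+1 == k) = (0 < k <= n))%N.
Proof.
elim: n k => [|n ih] k; first by rewrite big_ord0; case: k.
rewrite big_ord_recr/= ih; case: k => //= k.
by rewrite eqSS ltnS eqn_leq; case: (ltngtP k n).
Qed.

Lemma sum_nat_le (j i : nat) : (\sum_(l < j) (l.+1 <= i) = minn i j)%N.
Proof.
elim: j => [|j ih]; first by rewrite big_ord0 minn0.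
by rewrite big_ord_recr/= ih; case: (leqP j.+1 i) => ij; lia.
Qed.

(** Orthogonality: the constant 1 of D_i contributes [k = 0] and its term of frequency l+1
    contributes [l+1 = k], the sum frequency l+1+k never being zero. *)
Lemma circle_mean_dirichlet_harmonic i k :
  E (fun x => dirichlet i x * harmonic_cos k x) = (k <= i)%N%:R.
Proof.
transitivity (E (fun x => harmonic_cos k x + \sum_(l < i)
    (harmonic_cos (l.+1 + k) x + harmonic_cos `|l.+1 - k|%N x))).
  congr circle_mean; apply/funext => x.
  rewrite /dirichlet mulrDl mul1r mulr_sumr mulr_suml; congr (_ + _).
  by apply: eq_bigr => l _; rewrite -mulrA mul_harmonic_cos.
have ch n : continuous (harmonic_cos n : R -> R) by exact: continuous_harmonic_cos.
have c2 l : continuous (fun x : R =>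
    harmonic_cos (l.+1 + k) x + harmonic_cos `|l.+1 - k|%N x).
  by move=> x; apply: cvgD; exact: ch.
rewrite circle_meanD//; last exact: (continuous_sumr c2).
rewrite (circle_mean_sum _ c2) circle_mean_harmonic.
rewrite (eq_bigr (fun l : 'I_i => (l.+1 == k)%:R)); last first.
  move=> l _; rewrite circle_meanD// !circle_mean_harmonic.
  by rewrite addSn/= add0r distn_eq0.
rewrite -natr_sum sum_nat_eq -natrD.
by congr (_%:R); case: (posnP k) => [->|k0] /=; lia.
Qed.

(** Expanding D_j, its constant term gives 1 and each of the min(i, j) positive frequencies shared
    with D_i gives 2. *)
Lemma circle_mean_dirichletM i j :
  E (fun x => dirichlet i x * dirichlet j x) = (2 * minn i j).+1%:R.
Proof.
transitivity (E (fun x => dirichlet i x * harmonic_cos 0 x +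
    2 * \sum_(l < j) (dirichlet i x * harmonic_cos l.+1 x))).
  congr circle_mean; apply/funext => x.
  rewrite [dirichlet j x]/dirichlet /harmonic_cos mul0r cos0 mulrDr.
  by rewrite mulrCA mulr_sumr.
have cd k : continuous (fun x : R => dirichlet i x * harmonic_cos k x).
  by apply: continuousM_fun; [exact: continuous_dirichlet|exact: continuous_harmonic_cos].
have cs : continuous (fun x : R =>
    \sum_(l < j) (dirichlet i x * harmonic_cos l.+1 x)).
  exact: (@continuous_sumr _ j (fun l x => dirichlet i x * harmonic_cos l.+1 x)).
rewrite circle_meanD//; last by move=> x; apply: cvgMr; exact: cs.
rewrite circle_meanZ// (@circle_mean_sum j (fun l x => dirichlet i x * harmonic_cos l.+1 x))//.
rewrite circle_mean_dirichlet_harmonic leq0n.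
under eq_bigr do rewrite circle_mean_dirichlet_harmonic.
rewrite -natr_sum -natrM -natrD add1n; by rewrite sum_nat_le.
Qed.

Lemma circle_mean_fejer m : E (fejer m) = m%:R.
Proof.
rewrite (circle_mean_sum _ continuous_dirichlet).
have Ed i : E (dirichlet i) = 1.
  rewrite -[RHS]/((0 <= i)%N%:R : R) -(circle_mean_dirichlet_harmonic i 0).
  by congr circle_mean; apply/funext => x; rewrite /harmonic_cos mul0r cos0 mulr1.
by under eq_bigr do rewrite Ed; rewrite sumr_const card_ord.
Qed.

(** Induction through F_{m+1}^2 = F_m^2 + 2 F_m D_m + D_m^2, whose mean grows by 2 m^2 + (2m+1). *)
Lemma circle_mean_fejer_sqr m :
  E (fun x => fejer m x ^+ 2) = m%:R * (2 * m%:R ^+ 2 + 1) / 3.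
Proof.
elim: m => [|m ih].
  (* For m = 0 both F and its square are zero, so the known mean of F is reused. *)
  rewrite !mul0r -[RHS](circle_mean_fejer 0); congr circle_mean.
  by apply/funext => x; rewrite /fejer big_ord0 expr0n.
have cd := @continuous_dirichlet R.
have cf := @continuous_fejer R.
transitivity (E (fun x => fejer m x ^+ 2 + (2 * (\sum_(i < m) dirichlet i x * dirichlet m x)
    + dirichlet m x * dirichlet m x))).
  congr circle_mean; apply/funext => x.
  by rewrite {1}/fejer big_ord_recr/= -mulr_suml -/(fejer m x); ring.
have c1 : continuous (fun x : R => \sum_(i < m) dirichlet i x * dirichlet m x).
  apply: (@continuous_sumr _ m (fun i x => dirichlet i x * dirichlet m x)) => i.
  exact: continuousM_fun.
have c2 : continuous (fun x : R => 2 * \sum_(i < m) dirichlet i x * dirichlet m x).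
  by move=> x; apply: cvgMr; exact: c1.
have c3 : continuous (fun x : R => dirichlet m x * dirichlet m x).
  exact: continuousM_fun.
have c4 : continuous (fun x : R => fejer m x ^+ 2).
  exact: (@continuousM_fun (fejer m) (fejer m)).
rewrite circle_meanD//; last by move=> x; apply: cvgD; [exact: c2|exact: c3].
rewrite circle_meanD// circle_meanZ// ih circle_mean_dirichletM.
rewrite (@circle_mean_sum m (fun i x => dirichlet i x * dirichlet m x)); last first.
  by move=> i; exact: continuousM_fun.
(* For i < m the mean of D_i D_m is 2i+1, and the first m odd numbers add up to m^2. *)
rewrite (_ : \sum_(i < m) _ = m%:R ^+ 2); last first.
  under eq_bigr do rewrite circle_mean_dirichletM.
  rewrite -natr_sum -natrX; congr _%:R.
  rewrite (eq_bigr (fun i : 'I_m => (2 * i).+1)%N); last first.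
    by move=> i _; rewrite (minn_idPl (ltnW (ltn_ord i))).
  by elim: m {ih cf c1 c2 c3 c4} => [|m ih]; rewrite ?big_ord0// big_ord_recr/= ih; lia.
by rewrite minnn -!natr1 natrM; field.
Qed.

End circle_mean.

End circle_integral.

(** * Mass and first moment of the one-dimensional Jackson kernel *)

Section jackson_mean.
Context {R : realType}.
Local Notation circ := (@lebesgue_circle R).
Implicit Types (m : nat) (t y : R).

Lemma continuous_jackson1 m : continuous (@jackson1 R m).
Proof.
rewrite (_ : jackson1 m = fun t : R => jackson_const m * (fejer m t * fejer m t)).
  by move=> t; apply: cvgMr; apply: continuousM_fun; exact: continuous_fejer.
by apply/funext => t; rewrite jackson1_fejer.
Qed.

Lemma jackson_const_ge0 m : 0 <= jackson_const m :> R.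
Proof. by rewrite divr_ge0// mulr_ge0// addr_ge0// mulr_ge0// exprn_ge0. Qed.

Lemma jackson1_ge0 m t : 0 <= jackson1 m t.
Proof. by rewrite jackson1_fejer mulr_ge0 ?jackson_const_ge0 ?sqr_ge0. Qed.

(** Where sin(pi t) is nonzero this follows from [fejerE]; where it vanishes, every harmonic equals
    1 and F is a sum of nonnegative terms. *)
Lemma fejer_ge0 m t : 0 <= fejer m t.
Proof.
have [s0|s0] := eqVneq (sin (pi * t)) 0; last first.
  have s2 : 0 < sin (pi * t) ^+ 2 by rewrite exprn_even_gt0.
  by rewrite -(pmulr_lge0 _ s2) fejerE sqr_ge0.
have c1 : cos (pi *+ 2 * t) = 1.
  by rewrite mulrnAl cos_mulr2n cos2sin2 s0; ring.
have s1 : sin (pi *+ 2 * t) = 0.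
  by rewrite mulrnAl sin_mulr2n s0 mulr0 mul0rn.
have hc k : harmonic_cos k t = 1.
  rewrite /harmonic_cos; elim: k => [|k ih]; first by rewrite mul0r cos0.
  by rewrite -natr1 mulrDl mul1r cosD ih c1 s1; ring.
rewrite sumr_ge0// => j _; rewrite addr_ge0// mulr_ge0// sumr_ge0// => k _.
by rewrite hc.
Qed.

Lemma circle_mean_jackson1 m y : (0 < m)%N -> circle_mean y (jackson1 m) = 1.
Proof.
move=> m0; have m1 : 1 <= m%:R :> R by rewrite ler1n.
transitivity (circle_mean y (fun t => jackson_const m * (fejer m t ^+ 2))).
  by congr circle_mean; apply/funext => t; rewrite jackson1_fejer.
rewrite circle_meanZ.
  by rewrite circle_mean_fejer_sqr /jackson_const; field; apply/andP; split; nra.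
by apply: continuousM_fun; exact: continuous_fejer.
Qed.

(** Concavity through two mean values: sin u = u cos a and 1 - sin u = (pi/2 - u) cos b with a < u <
    b. As cos b <= cos a, adding gives 1 <= (pi/2) cos a; multiply by u. *)
Lemma jordan_sin (u : R) : 0 <= u <= pi / 2 -> u <= pi / 2 * sin u.
Proof.
have pi0 := pi_gt0 R.
move=> /andP[]; rewrite le_eqVlt => /predU1P[<-|u0]; first by rewrite sin0 mulr0.
rewrite le_eqVlt => /predU1P[->|u1]; first by rewrite sin_pihalf mulr1.
have csin (a b : R) : {within `[a, b], continuous sin}.
  by apply: continuous_subspaceT => x; exact: continuous_sin.
have [a] := MVT u0 (fun x _ => is_derive_sin x) (csin _ _).
rewrite in_itv/= sin0 !subr0 => /andP[a0 au] ea.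
have [b] := MVT u1 (fun x _ => is_derive_sin x) (csin _ _).
rewrite in_itv/= sin_pihalf => /andP[ub b1] eb.
have ba : cos b <= cos a.
  by apply: ltW; rewrite ltr_cos ?in_itv/=; [lra|apply/andP; split; lra..].
have h : cos b * (pi / 2 - u) <= cos a * (pi / 2 - u) by rewrite ler_wpM2r//; lra.
have h1 : 1 <= cos a * (pi / 2).
  by rewrite -eb ea in h; rewrite mulrBr in h; lra.
by rewrite ea mulrA ler_peMl ?(ltW u0)// mulrC.
Qed.

(** A continuous 1-periodic majorant of the distance to the integers; unlike that distance, its
    product with the Jackson kernel has a mean bounded by known kernel means. *)
Definition wrap_weight m t : R := 1 / (4 * m%:R) + m%:R / 4 * sin (pi * t) ^+ 2.

Lemma wrap_weight_ge0 m t : 0 <= wrap_weight m t.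
Proof.
apply: addr_ge0; first by rewrite divr_ge0// mulr_ge0.
by apply: mulr_ge0; rewrite ?sqr_ge0// divr_ge0.
Qed.

Lemma continuous_wrap_weight m : continuous (wrap_weight m).
Proof.
move=> t; apply: cvgD; first exact: cvg_cst.
have cs : continuous (fun t : R => sin (pi * t)).
  move=> s; apply: (@continuous_comp _ _ _ (fun s => pi * s) sin).
    by apply: cvgMr; exact: cvg_id.
  exact: continuous_sin.
by apply: cvgMr; exact: (@continuousM_fun _ (fun t => sin (pi * t)) (fun t => sin (pi * t))).
Qed.

(** With s = sin(pi |t|), Jordan's inequality gives |t| <= s/2, and the weight exceeds s/2 by (m s -
    1)^2 / (4m). *)
Lemma le_wrap_weight m t : (0 < m)%N -> `|t| <= 2^-1 -> `|t| <= wrap_weight m t.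
Proof.
move=> m0 t2; have pi0 := pi_gt0 R.
have m1 : 0 < m%:R :> R by rewrite ltr0n.
have : pi * `|t| <= pi / 2 * sin (pi * `|t|).
  by apply: jordan_sin; rewrite mulr_ge0 ?pi_ge0//= ler_pM2l.
have -> : wrap_weight m t = wrap_weight m `|t|.
  by rewrite /wrap_weight; have [//|_] := ger0P t; rewrite mulrN sinN sqrrN.
rewrite -mulrA ler_pM2l// /wrap_weight; set s := sin _ => h.
apply: (le_trans h).
have : 0 <= (m%:R * s - 1) ^+ 2 / (4 * m%:R) by rewrite divr_ge0 ?sqr_ge0// mulr_ge0// ltW.
suff -> : (m%:R * s - 1) ^+ 2 / (4 * m%:R) = 1 / (4 * m%:R) + m%:R / 4 * s ^+ 2 - 2^-1 * s by lra.
by field; rewrite gt_eqF.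
Qed.

Lemma wrap_weightDint m t (k : int) : wrap_weight m (t + k%:~R) = wrap_weight m t.
Proof.
rewrite /wrap_weight mulrDr sinD.
have sk : sin (pi * k%:~R : R) = 0.
  have sn (n : nat) : sin (pi * n%:R : R) = 0.
    elim: n => [|n ih]; first by rewrite mulr0 sin0.
    by rewrite -natr1 mulrDr mulr1 sinDpi ih oppr0.
  case: k => n; first exact: sn.
  by rewrite NegzE rmorphN mulrN sinN /= sn oppr0.
have := cos2Dsin2 (pi * k%:~R : R); rewrite sk expr0n/= addr0 => ck.
by rewrite mulr0 addr0 exprMn ck mulr1.
Qed.

Lemma exists_wrap m t : (0 < m)%N ->
  exists k : int, `|t + k%:~R| <= wrap_weight m t.
Proof.
(* Subtracting the nearest integer brings t into [-1/2, 1/2); periodicity leaves the weight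
   unchanged. *)
move=> m0; exists (- Num.floor (t + 2^-1)).
rewrite -(wrap_weightDint m t (- Num.floor (t + 2^-1))).
apply: le_wrap_weight => //; rewrite rmorphN/= ler_norml.
have := floor_itv (t + 2^-1); rewrite rmorphD/= => /andP[? ?].
by apply/andP; split; lra.
Qed.

Lemma circle_mean_wrap_weight_jackson1 m y : (0 < m)%N ->
  circle_mean y (fun t => wrap_weight m t * jackson1 m t) <= 3 / (4 * m%:R).
Proof.
move=> m0; have m1 : 1 <= m%:R :> R by rewrite ler1n.
pose c : R := m%:R / 4 * jackson_const m.
have c0 : 0 <= c by rewrite mulr_ge0 ?jackson_const_ge0// divr_ge0.
have cJ := @continuous_jackson1 m.
have cf := @continuous_fejer R m.
have cw := @continuous_wrap_weight m.
have cc : continuous (fun t : R => 1 / (4 * m%:R) * jackson1 m t).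
  by move=> t; apply: cvgMr; exact: cJ.
have cc' : continuous (fun t : R => c * fejer m t).
  by move=> t; apply: cvgMr; exact: cf.
apply: (@le_trans _ _ (circle_mean y
    (fun t => 1 / (4 * m%:R) * jackson1 m t + c * fejer m t))).
  apply: le_Rintegral => //=.
  - apply: (@integrable_circle _ (fun x => wrap_weight m (x - y) * jackson1 m (x - y))).
    by apply: (@continuous_shift _ y (fun t => wrap_weight m t * jackson1 m t));
      exact: continuousM_fun.
  - apply: (@integrable_circle _ (fun x =>
      1 / (4 * m%:R) * jackson1 m (x - y) + c * fejer m (x - y))).
    apply: (@continuous_shift _ y (fun t => 1 / (4 * m%:R) * jackson1 m t + c * fejer m t)).
    by move=> t; apply: cvgD; [exact: cc|exact: cc'].
  move=> x _; set t := val x - y.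
  rewrite /wrap_weight mulrDl lerD2l /c jackson1_fejer.
  rewrite [leLHS](_ : _ = c * (fejer m t * (fejer m t * sin (pi * t) ^+ 2))); last first.
    by rewrite /c; ring.
  rewrite fejerE; apply: ler_wpM2l => //; apply: ler_piMr; first exact: fejer_ge0.
  by rewrite sin2cos2 gerBl sqr_ge0.
rewrite circle_meanD// circle_meanZ// circle_meanZ// circle_mean_jackson1// circle_mean_fejer.
rewrite /c /jackson_const.
set M := m%:R in m1 *.
rewrite -subr_ge0.
(* The constant term averages to 1/(4M) and the sine term to at most 3M / (4 (2M^2+1)); the gap to
   3/(4M) is the positive fraction on the right. *)
have -> : 3 / (4 * M) - (1 / (4 * M) * 1 + M / 4 * (3 / (M * (2 * M ^+ 2 + 1))) * M) =
   (M ^+ 2 + 2) / (4 * M * (2 * M ^+ 2 + 1)).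
  field; apply/andP; split; nra.
by rewrite divr_ge0//; nra.
Qed.

End jackson_mean.

(** * The torus *)

Section torus_geometry.
Context {R : realType} {d : nat}.
Implicit Types (x y : torus d R) (f : torus d R -> R).

Lemma torus_dist_le x y (k : 'I_d -> int) :
  torus_dist x y <= \sum_(i < d) `|torus_coord x i - torus_coord y i + (k i)%:~R|.
Proof.
apply: ge_inf; last by exists k.
by exists 0 => _ [j _ <-]; exact: sumr_ge0.
Qed.

Lemma torus_coord_ge0 x i : 0 <= torus_coord x i.
Proof. by rewrite /torus_coord; case: (tnth x i) => t /= /andP[]. Qed.

Lemma torus_coord_lt1 x i : torus_coord x i < 1.
Proof. by rewrite /torus_coord; case: (tnth x i) => t /= /andP[]. Qed.

Lemma torus_coordB_norm x y i : `|torus_coord x i - torus_coord y i| <= 1.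
Proof.
have := torus_coord_ge0 x i; have := torus_coord_lt1 x i.
have := torus_coord_ge0 y i; have := torus_coord_lt1 y i.
by rewrite ler_norml => *; apply/andP; split; lra.
Qed.

Lemma torus_dist_le_l1 x y :
  torus_dist x y <= \sum_(i < d) `|torus_coord x i - torus_coord y i|.
Proof.
apply: (le_trans (torus_dist_le x y (fun=> 0))).
by apply: ler_sum => i _; rewrite addr0.
Qed.

Lemma torus_dist_le_dim x y : torus_dist x y <= d%:R.
Proof.
apply: (le_trans (torus_dist_le_l1 x y)).
rewrite -[leRHS](_ : \sum_(i < d) 1 = _); last by rewrite sumr_const card_ord.
by apply: ler_sum => i _; exact: torus_coordB_norm.
Qed.

(** Each coordinate is wrapped by its own integer, and these integers together form one competitor
    in the infimum. *)
Lemma torus_dist_le_wrap_weight m x y : (0 < m)%N ->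
  torus_dist x y <=
  \sum_(i < d) wrap_weight m (torus_coord x i - torus_coord y i).
Proof.
move=> m0.
have [k kP] := choice (fun i : 'I_d =>
  exists_wrap (torus_coord x i - torus_coord y i) m0).
by apply: (le_trans (torus_dist_le x y k)); apply: ler_sum => i _; exact: kP.
Qed.

Lemma measurable_torus_coord i : measurable_fun setT (fun x => torus_coord x i).
Proof.
apply: measurableT_comp; first exact: measurable_circle_val.
exact: measurable_tnth.
Qed.

Lemma Lip1_bounded f : Lip1 f -> exists B, forall x, `|f x| <= B.
Proof.
move=> Lf; exists (d%:R + `|f point|) => x.
rewrite -[f x](subrK (f point)); apply: (le_trans (ler_normD _ _)).
by rewrite lerD2r; apply: (le_trans (Lf _ _)); exact: torus_dist_le_dim.
Qed.

(** The cell of side 1/(N+1) containing x. Coordinates are below 1, so the default of [inord] is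
    never reached; the same goes for [insubd] in [grid_point]. *)
Definition grid_index N x : {ffun 'I_d -> 'I_N.+1} :=
  [ffun i => inord (Num.trunc (N.+1%:R * torus_coord x i))].

Definition grid_point N (t : {ffun 'I_d -> 'I_N.+1}) : torus d R :=
  [tuple insubd (point : circle R) ((t i)%:R / N.+1%:R : R) | i < d].

Lemma grid_indexE N x i :
  grid_index N x i = Num.trunc (N.+1%:R * torus_coord x i) :> nat.
Proof.
rewrite ffunE inordK// truncn_lt_nat; last by rewrite mulr_ge0// torus_coord_ge0.
by rewrite gtr_pMr ?ltr0n// torus_coord_lt1.
Qed.

Lemma torus_coord_grid_point N (t : {ffun 'I_d -> 'I_N.+1}) i :
  torus_coord (grid_point t) i = (t i)%:R / N.+1%:R.
Proof.
rewrite /torus_coord tnth_mktuple val_insubd divr_ge0//=.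
by rewrite ltr_pdivrMr ?ltr0n// mul1r ltr_nat ltn_ord.
Qed.

Lemma torus_dist_grid N x :
  torus_dist x (grid_point (grid_index N x)) <= d%:R / N.+1%:R.
Proof.
apply: (le_trans (torus_dist_le_l1 _ _)).
rewrite -[leRHS](_ : \sum_(i < d) N.+1%:R^-1 = _); last first.
  by rewrite sumr_const card_ord mulr_natl.
apply: ler_sum => i _; rewrite torus_coord_grid_point grid_indexE.
have N0 : 0 < N.+1%:R :> R by rewrite ltr0n.
have : 0 <= N.+1%:R * torus_coord x i by rewrite mulr_ge0// torus_coord_ge0.
move/truncn_itv; set j := Num.trunc _; rewrite -[j.+1%:R]natr1 => /andP[j1 j2].
have -> : torus_coord x i - j%:R / N.+1%:R =
  (N.+1%:R * torus_coord x i - j%:R) / N.+1%:R by field; rewrite gt_eqF.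
rewrite normrM [X in _ * X]gtr0_norm ?invr_gt0// ger0_norm; last by lra.
by rewrite ler_piMl ?invr_ge0//; lra.
Qed.

(** A finite sum over cells of the value of f at a corner times the indicator of the cell, which is
    a product of coordinate level sets with offset B = 0. *)
Lemma measurable_grid N f :
  measurable_fun setT (fun x => f (grid_point (grid_index N x))).
Proof.
rewrite (_ : (fun _ => _) = fun x => \sum_(t : {ffun 'I_d -> 'I_N.+1})
    f (grid_point t) * \prod_(i < d) \1_(level_set ((@torus_coord d R)^~ i) 0 N (t i)) x).
  apply: measurable_sum => t; apply: measurable_funM => //.
  apply: measurable_prod => i _; apply: measurable_indic.
  by apply: measurable_level_set; exact: measurable_torus_coord.
apply/funext => x; rewrite (bigD1 (grid_index N x))//= [X in _ + X]big1.
  rewrite addr0 big1 ?mulr1// => i _; rewrite indicE mem_set//.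
  by rewrite /level_set/= addr0 grid_indexE.
move=> t tx; have [i ti] : exists i, t i != grid_index N x i.
  apply/existsP; move: tx; apply: contraNT; rewrite negb_exists => /forallP tE.
  by apply/eqP/ffunP => i; apply/eqP; rewrite -[_ == _]negbK tE.
rewrite (bigD1 i)//= indicE memNset ?mul0r ?mulr0//.
rewrite /level_set/= addr0 => tiE; move/eqP : ti; apply.
by apply: val_inj; rewrite /= grid_indexE.
Qed.

(** Replacing x by the corner of its cell changes f by at most d/(N+1), so f is a pointwise limit of
    grid functions, measurable for the product sigma-algebra. *)
Lemma Lip1_measurable f : Lip1 f -> measurable_fun setT f.
Proof.
move=> Lf; apply: (measurable_fun_cvg (measurable_grid ^~ f)) => x _.
apply/cvgrPdist_le => e e0; near=> N.
apply: (le_trans (Lf _ _)); apply: (le_trans (torus_dist_grid _ _)).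
rewrite ler_pdivrMr ?ltr0n// -ler_pdivrMl// mulrC.
rewrite (le_trans (ltW (truncnS_gt _)))// ler_nat ltnS.
by near: N; exact: nbhs_infty_ge.
Unshelve. all: by end_near.
Qed.

End torus_geometry.

(** * Integrals of products over tuples *)

Section tuple_integral.
Context d (T : measurableType d) (R : realType) (P : probability T R).

Lemma measurable_tuple_prod n (g : 'I_n -> T -> R) :
  (forall i, measurable_fun setT (g i)) ->
  measurable_fun setT (fun x : n.-tuple T => \prod_(i < n) g i (tnth x i)).
Proof.
move=> mg; apply: measurable_prod => i _.
by apply: measurableT_comp (measurable_tnth _).
Qed.

(** Induction on n: the law on (n+1)-tuples is the image under cons of a product measure, and
    nonnegativity lets Tonelli split off the first factor. *)
Lemma integral_tuple_prod n (g : 'I_n -> T -> R) (r : 'I_n -> R) :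
  (forall i, measurable_fun setT (g i)) -> (forall i x, 0 <= g i x) ->
  (forall i, (\int[P]_x (g i x)%:E)%E = (r i)%:E) ->
  (\int[tuple_probability P n]_x (\prod_(i < n) g i (tnth x i))%:E)%E =
  (\prod_(i < n) r i)%:E.
Proof.
elim: n g r => [|n ih] g r mg g0 gr.
  under eq_integral do rewrite big_ord0.
  by rewrite big_ord0 integral_cst//= probability_setT mule1.
have mG : measurable_fun setT (EFin \o (fun x : n.+1.-tuple T => \prod_(i < n.+1) g i (tnth x i))).
  by apply/measurable_EFinP; exact: measurable_tuple_prod.
rewrite /= /distribution ge0_integral_pushforward//=; last first.
  by move=> x _; rewrite lee_fin prodr_ge0.
rewrite preimage_setT.
rewrite fubini_tonelli1//=; last 2 first.
- by apply: (measurableT_comp mG); exact: measurable_consT.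
- by move=> x; rewrite lee_fin prodr_ge0.
rewrite /fubini_F.
have r0 i : 0 <= r i by rewrite -lee_fin -gr integral_ge0// => x _; rewrite lee_fin.
transitivity (\int[P]_x ((g ord0 x)%:E * (\prod_(i < n) r (lift ord0 i))%:E))%E.
  apply: eq_integral => x _.
  rewrite -(ih (fun i => g (lift ord0 i)) (fun i => r (lift ord0 i)))//.
  rewrite -ge0_integralZl_EFin//; last 2 first.
  - by move=> t _; rewrite lee_fin prodr_ge0.
  - by apply/measurable_EFinP; apply: (measurable_tuple_prod (g := fun i => g (lift ord0 i))).
  apply: eq_integral => t _; rewrite -EFinM big_ord_recl/=; congr (_ * _)%:E.
  by apply: eq_bigr => i _; rewrite tnthS.
rewrite ge0_integralZr//.
- by rewrite gr -EFinM big_ord_recl.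
- exact/measurable_EFinP.
- by move=> x _; rewrite lee_fin.
- by rewrite lee_fin prodr_ge0.
Qed.

End tuple_integral.

(** * Mass and first moment of the Jackson kernel on the torus *)

Section torus_jackson.
Context {R : realType} {d : nat} (m : nat) (m_gt0 : (0 < m)%N).
Local Notation circ := (@lebesgue_circle R).
Local Notation lam := (lebesgue_torus d R).
Implicit Types (x y : torus d R).

Definition jackson_kernel (z : torus d R * torus d R) : R :=
  jackson m (fun i => torus_coord z.1 i - torus_coord z.2 i).

Lemma jackson_kernel_ge0 z : 0 <= jackson_kernel z.
Proof. by rewrite /jackson_kernel /jackson prodr_ge0// => i _; exact: jackson1_ge0. Qed.

Lemma measurable_continuous_torus_coordB (g : R -> R) i : continuous g ->
  measurable_fun setT
    (fun z : torus d R * torus d R => g (torus_coord z.1 i - torus_coord z.2 i)).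
Proof.
move=> cg.
apply: (measurableT_comp (continuous_measurable_fun cg)).
by apply: measurable_funB; apply: measurableT_comp (measurable_torus_coord i) _.
Qed.

Lemma measurable_jackson_kernel : measurable_fun setT jackson_kernel.
Proof.
apply: measurable_prod => i _.
apply: (measurable_continuous_torus_coordB (g := jackson1 m)).
exact: continuous_jackson1.
Qed.

(** Differences of representatives lie in [-1, 1], where the continuous one-dimensional kernel is
    bounded. *)
Lemma jackson_kernel_bounded : exists M, forall z, `|jackson_kernel z| <= M.
Proof.
have N11 : -1 <= 1 :> R by lra.
have [M JM] := continuous_bounded_itv N11 (@continuous_jackson1 R m).
exists (\prod_(i < d) M) => z.
rewrite /jackson_kernel /jackson normr_prod; apply: ler_prod => i _; rewrite normr_ge0/=.
by apply: JM; rewrite -ler_norml; exact: torus_coordB_norm.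
Qed.

Lemma integral_circle_mean (g : R -> R) (s : R) : continuous g ->
  (\int[circ]_x (g (val x - s))%:E)%E = (circle_mean s g)%:E.
Proof.
move=> cg; rewrite fineK//; apply: integrable_fin_num => //.
exact: (@integrable_circle R (fun t => g (t - s)) (@continuous_shift R s g cg)).
Qed.

Lemma integral_torus_prod (g : 'I_d -> R -> R) y :
  (forall i, continuous (g i)) -> (forall i t, 0 <= g i t) ->
  (\int[lam]_x (\prod_(i < d) g i (torus_coord x i - torus_coord y i))%:E)%E =
  (\prod_(i < d) circle_mean (torus_coord y i) (g i))%:E.
Proof.
move=> cg g0.
apply: (integral_tuple_prod (P := circ)
  (g := fun i (t : circle R) => g i (val t - torus_coord y i))) => // i.
- apply: (measurableT_comp (continuous_measurable_fun (cg i))).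
  by apply: measurable_funB => //; exact: measurable_circle_val.
- exact: integral_circle_mean.
Qed.

Lemma integral_jackson_kernel y :
  (\int[lam]_x (jackson_kernel (x, y))%:E = 1)%E.
Proof.
rewrite (@integral_torus_prod (fun=> jackson1 m)) => [|i|i t].
- by rewrite big1// => i _; exact: circle_mean_jackson1.
- exact: continuous_jackson1.
- exact: jackson1_ge0.
Qed.

Lemma integral_wrap_weight_jackson_kernel y :
  (\int[lam]_x (\sum_(i < d) wrap_weight m (torus_coord x i - torus_coord y i) *
     jackson_kernel (x, y))%:E <= (d%:R * (3 / (4 * m%:R)))%:E)%E.
Proof.
(* The weight of coordinate i is absorbed into the i-th factor of the kernel, so each summand is
   again a product; its other factors have mean 1. *)
pose g (i j : 'I_d) (t : R) : R := if j == i then wrap_weight m t * jackson1 m t else jackson1 m t.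
have cg i j : continuous (g i j).
  rewrite /g; case: (j == i); last exact: continuous_jackson1.
  by apply: continuousM_fun; [exact: continuous_wrap_weight|exact: continuous_jackson1].
have g0 i j t : 0 <= g i j t.
  by rewrite /g; case: ifP => _; rewrite ?mulr_ge0 ?wrap_weight_ge0 ?jackson1_ge0.
have gE i x : wrap_weight m (torus_coord x i - torus_coord y i) * jackson_kernel (x, y) =
    \prod_(j < d) g i j (torus_coord x j - torus_coord y j).
  rewrite /jackson_kernel /jackson (bigD1 i)//= [RHS](bigD1 i)//= {1}/g eqxx mulrA.
  by congr (_ * _); apply: eq_bigr => j ji; rewrite /g (negbTE ji).
under eq_integral do rewrite -sumEFin.
rewrite ge0_integral_sum//; last 2 first.
- move=> i; apply/measurable_EFinP; under eq_fun do rewrite gE.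
  apply: (measurable_prod2 (k := fun z : torus d R * torus d R =>
    \prod_(j < d) g i j (torus_coord z.1 j - torus_coord z.2 j))).
  by apply: measurable_prod => j _; exact: measurable_continuous_torus_coordB.
- by move=> i x _; rewrite gE lee_fin prodr_ge0.
rewrite [leRHS](_ : _ = \sum_(i < d) (3 / (4 * m%:R))%:E)%E; last first.
  by rewrite sumEFin sumr_const card_ord mulr_natl.
apply: lee_sum => i _; under eq_integral do rewrite gE.
rewrite integral_torus_prod// lee_fin (bigD1 i)//= [X in _ * X]big1 ?mulr1.
  rewrite (_ : g i i = fun t => wrap_weight m t * jackson1 m t); last first.
    by rewrite /g eqxx.
  exact: circle_mean_wrap_weight_jackson1.
by move=> j ji; rewrite /g (negbTE ji) circle_mean_jackson1.
Qed.

End torus_jackson.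

(** * The smoothing error of a Lipschitz test function *)

Section jackson_error.
Context {R : realType} {d : nat} (m : nat) (m_gt0 : (0 < m)%N).
Local Notation lam := (lebesgue_torus d R).
Local Notation J := (@jackson_kernel R d m).
Variable f : torus d R -> R.
Hypothesis Lf : Lip1 f.

Definition jackson_error (y : torus d R) : R :=
  (\int[lam]_x (f x * J (x, y)))%R - f y.

Lemma jackson_smoothing_regular :
  measurable_fun setT (fun y => \int[lam]_x (f x * J (x, y)))%R /\
  exists C, forall y, `|\int[lam]_x (f x * J (x, y))|%R <= C.
Proof.
have [B fB] := Lip1_bounded Lf; have mf := Lip1_measurable Lf.
have mJ := @measurable_jackson_kernel R d m; have [M JM] := @jackson_kernel_bounded R d m.
pose k z := f z.1 * J z.
have mk : measurable_fun setT k.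
  by apply: measurable_funM => //; exact: measurableT_comp.
have kBM z : `|k z| <= B * M by rewrite normrM ler_pM.
split; first exact: (measurable_Rintegral2 lam lam mk kBM).
exists (B * M * fine (lam setT)) => y.
apply: (Rintegral_norm_le lam (measurable_prod2 mk y)) => x.
exact: kBM.
Qed.

(** Subtraction, density and Fubini move the convolution onto f. Treating one real charge at a time
    lets the result serve both [re_part] and [im_part]. *)
Lemma charge_integral_jackson_error (nu : {charge set (torus d R) -> \bar R}) :
  charge_integral (cadd (charge_density lam
    (fun x => charge_integral nu (fun y => J (x, y)))) (copp nu)) f =
  charge_integral nu jackson_error.
Proof.
have [B fB] := Lip1_bounded Lf; have mf := Lip1_measurable Lf.
have mJ := @measurable_jackson_kernel R d m; have [M JM] := @jackson_kernel_bounded R d m.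
rewrite (charge_integral_caddN _ _ mf fB).
have mg := measurable_charge_integral lam nu mJ JM.
have [C gC] := charge_integral_bounded nu mJ JM.
rewrite (charge_integral_density lam mf fB mg gC).
rewrite (charge_integral_fubini lam nu mJ JM mf fB).
have [mh [D hD]] := jackson_smoothing_regular.
by rewrite -(charge_integralB nu mh hD mf fB).
Qed.

Lemma jackson_error_le y : `|jackson_error y| <= d%:R * (3 / (4 * m%:R)).
Proof.
have [B fB] := Lip1_bounded Lf; have mf := Lip1_measurable Lf.
have mJ := @measurable_jackson_kernel R d m; have [M JM] := @jackson_kernel_bounded R d m.
have mJy := measurable_prod2 mJ y.
have iJ : lam.-integrable setT (EFin \o (fun x => J (x, y))).
  by apply: (bounded_measurable_integrable lam mJy) => x; exact: JM.
have ifJ : lam.-integrable setT (EFin \o (fun x => f x * J (x, y))).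
  apply: (@bounded_measurable_integrable _ _ _ lam _ (B * M)).
    exact: measurable_funM.
  by move=> x; rewrite normrM ler_pM.
have J1 : (\int[lam]_x J (x, y) = 1)%R.
  by rewrite /Rintegral integral_jackson_kernel.
have icJ : lam.-integrable setT (EFin \o (fun x => f y * J (x, y))).
  apply: (@bounded_measurable_integrable _ _ _ lam _ (B * M)).
    exact: measurable_funM.
  by move=> x; rewrite normrM ler_pM.
(* The kernel has mass 1 in x, so the error becomes the integral of (f x - f y) J(x, y), and the
   Lipschitz bound with [wrap_weight] applies under the integral. *)
have fyE : (f y = \int[lam]_x (f y * J (x, y)))%R.
  by rewrite RintegralZl// J1 mulr1.
rewrite /jackson_error [X in _ - X]fyE -RintegralB//.
rewrite -lee_fin EFin_normr_Rintegral//; last first.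
  rewrite (_ : _ \o _ = (EFin \o (fun x => f x * J (x, y))%R) \-
    (EFin \o (fun x => f y * J (x, y))%R))%E; [exact: integrableB|by []].
have mfJ : measurable_fun setT (fun x => f x * J (x, y) - f y * J (x, y)).
  by apply: measurable_funB; exact: measurable_funM.
apply: (le_trans (le_abse_integral _ _ _)) => //; first exact/measurable_EFinP.
apply: le_trans (integral_wrap_weight_jackson_kernel m_gt0 y).
apply: ge0_le_integral => //.
- by apply: measurableT_comp => //; exact/measurable_EFinP.
- apply/measurable_EFinP; apply: measurable_sum => i; apply: measurable_funM => //.
  apply: (measurable_prod2 (k := fun z : torus d R * torus d R =>
    wrap_weight m (torus_coord z.1 i - torus_coord z.2 i))).
  exact: (measurable_continuous_torus_coordB i (@continuous_wrap_weight R m)).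
- move=> x _; rewrite lee_fin -mulrBl normrM (ger0_norm (jackson_kernel_ge0 _ _)).
  rewrite -mulr_suml ler_wpM2r ?jackson_kernel_ge0//.
  by apply: (le_trans (Lf _ _)); exact: torus_dist_le_wrap_weight.
Qed.

End jackson_error.

Unset Implicit Arguments.

Theorem mainTheorem5 (R : realType) (d m n : nat) (hd : (0 < d)%N)
    (hm : (0 < m)%N) (hn : n = (2 * m - 2)%N)
    (mu : complex_measure (torus d R) R) (hmu : calM mu) :
  (W1_density (jackson_conv m mu) mu <=
    (3 / 2)%:E * (d%:R%:E * tv_norm mu / (n + 2)%:R%:E))%E.
Proof.
have [tvoo _] := hmu; apply: ge_ereal_sup => _ [f Lf <-].
have -> : cintegral (cmeasure_sub (cdensity (lebesgue_torus d R) (jackson_conv m mu)) mu) f =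
    cintegral mu (jackson_error m f).
  by rewrite /cintegral /= !(charge_integral_jackson_error m Lf).
have [mh [C hC]] := jackson_smoothing_regular m Lf.
have := @le_cintegral_tv_norm _ _ R mu (jackson_error m f) (d%:R * (3 / (4 * m%:R))).
move=> /(_ _ _ (jackson_error_le hm Lf) tvoo) h.
apply: (le_trans (h _ _)).
- by rewrite mulr_ge0// divr_ge0// mulr_ge0.
- by apply: measurable_funB => //; exact: Lip1_measurable.
(* The truncated subtraction 2m - 2 is exact because m > 0. *)
have n2 : (n + 2 = 2 * m)%N by rewrite hn subnK// leq_pmulr.
have m0 : m%:R != 0 :> R by rewrite pnatr_eq0 -lt0n.
have tv0 : (0 <= tv_norm mu)%E.
  exact: tv_norm_ge0.
rewrite n2 -(fineK (_ : tv_norm mu \is a fin_num)) ?ge0_fin_numE//.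
rewrite inver pnatr_eq0 muln_eq0/= (negbTE (lt0n_neq0 hm)) -!EFinM lee_fin natrM.
(* The two sides are equal: 3/(4m) is 3/2 divided by 2m. *)
by rewrite le_eqVlt; apply/orP; left; apply/eqP; field.
Qed.
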